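(* Let $J\subset\mathbb R$ be an interval, let $A$ be a continuous real $n\times n$ matrix function on $J$, let $f\colon J\to\mathbb R^n$ be continuous, and let $G$ be a multiplicative group of real continuously differentiable on $J$ nonsingular matrices of order $n$. Suppose the system $\dfrac{dx}{dt}=A(t)x+f(t)$ is reducible to the system $\dfrac{dy}{dt}=By+\mathrm g(t)f(t)$, $B$ a constant matrix, by a transformation matrix $\mathrm g\in G$, and let $C=B^{T}$. Let $\lambda$ be an eigenvalue of $C$ with an elementary divisor of multiplicity $m\geq2$, corresponding to a real eigenvector $\nu^{0}$ and to real generalized eigenvectors $\nu^{k}$ of order $k$, $k=1,\dots,m-1$. Fix $t_0\in J$ and define recursively $$C_k(t)=\int_{t_0}^{t}\bigl(\nu^{k}\mathrm g(\zeta)f(\zeta)\exp(-\lambda\zeta)+k\,C_{k-1}(\zeta)\bigr)\,d\zeta\quad\text{for all }t\in J,\quad k=0,\dots,m-1$$ (the term $k\,C_{k-1}$ being $0$ for $k=0$), the first integral $$F_1(t,x)=\nu^{0}\mathrm g(t)x\,\exp(-\lambda t)-C_0(t)\quad\text{for all }(t,x)\in J\times\mathbb R^n,$$ and $$F_{k+1}(t,x)=\nu^{k}\mathrm g(t)x\,\exp(-\lambda t)-\sum_{\tau=0}^{k-1}\binom{k}{\tau}t^{k-\tau}F_{\tau+1}(t,x)-C_k(t)\quad\text{for all }(t,x)\in J\times\mathbb R^n,\quad k=1,\dots,m-1.$$ Then the functions $F_{k+1}$, $k=1,\dots,m-1$, are functionally independent first integrals of the system $\dfrac{dx}{dt}=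A(t)x+f(t)$.
   Context: Vectors $\nu$ act as rows in $\nu\,\mathrm g(t)x$ (i.e. $\nu y=\sum_\xi\nu_\xi y_\xi$ with $y=\mathrm g(t)x$) and as columns when multiplied by $C$. If $C\nu^{0}=\lambda\nu^{0}$, $\nu^0\ne0$, non-zero vectors $\nu^{k}$ are called generalized eigenvectors of order $k$ if $(C-\lambda E)\nu^{k}=k\,\nu^{k-1}$, $k=1,\dots,m-1$, $E$ the identity matrix. The system $dx/dt=A(t)x+f(t)$ is reducible to $dy/dt=By+\mathrm g(t)f(t)$ ($B$ a real constant $n\times n$ matrix) by $\mathrm g\in G$ if the substitution $y=\mathrm g(t)x$ transforms the first system into the second; in particular $\dfrac{d\,\mathrm g(t)}{dt}=B\,\mathrm g(t)-\mathrm g(t)A(t)$ for all $t\in J$. A first integral of $dx/dt=X(t,x)$ on a domain $G'$ (open arcwise connected set) is a continuously differentiable function $F\colon G'\to\mathbb R$ with $\partial_tF(t,x)+\sum_{\xi=1}^nX_\xi(t,x)\,\partial_{x_\xi}F(t,x)=0$ for all $(t,x)\in G'$. *)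

(* Defs.v *)
From mathcomp Require Import all_boot all_order all_algebra.
From mathcomp Require Import all_classical all_reals all_analysis.

Set Implicit Arguments.
Unset Strict Implicit.
Unset Printing Implicit Defensive.

Import Order.TTheory GRing.Theory Num.Theory.
Import numFieldNormedType.Exports.

Local Open Scope classical_set_scope.
Local Open Scope ring_scope.

(* [h] has derivative [d] at [t] relative to [J]: the difference quotient only
   uses arguments in [J].  It is the usual derivative at interior points of [J]
   (see [deriv_inP]) and the one-sided one at an endpoint of an interval. *)
Definition deriv_in (R : realType) (V : normedModType R) (J : set R)
    (h : R -> V) (t : R) (d : V) : Prop :=
  e^-1 *: (h (e + t) - h t)
    @[e --> within [set e | J (e + t)] (0 : R)^'] --> d.

Lemma deriv_inP (R : realType) (V : normedModType R) (J : set R)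
    (h : R -> V) (t : R) (d : V) :
  J° t -> deriv_in J h t d <-> is_derive t 1 h d.
Proof.
move=> Jt.
have nJ : \forall e \near (0 : R)^', J (e + t).
  apply: nbhs_dnbhs.
  have : (fun e : R => e + t) @ (0 : R) --> (0 : R) + t.
    by apply: cvgD; [exact: cvg_id | exact: cvg_cst].
  by rewrite add0r; apply.
have eqF : within [set e : R | J (e + t)] (0 : R)^' = (0 : R)^'.
  rewrite eqEsubset; split => P /= HP.
    by apply: filterS2 nJ HP => e Je; apply.
  by apply: filterS HP => e Pe _.
have eqh : (fun e : R => e^-1 *: (h (e + t) - h t)) =
           (fun e : R => e^-1 *: ((h \o shift t) (e *: 1) - h t)).
  by apply/funext => e /=; rewrite /GRing.scale /= mulr1.
rewrite /deriv_in eqF eqh; split => [hd|[dh <-]].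
  by split; [apply/cvg_ex; exists d | exact: cvg_lim].
exact: dh.
Qed.

Definition C1_in (R : realType) (V : normedModType R) (J : set R) (h : R -> V) :
    Prop :=
  exists h' : R -> V,
    (forall t, J t -> deriv_in J h t (h' t)) /\ {within J, continuous h'}.

Definition oriented_integral (R : realType) (a b : R) (h : R -> R) : R :=
  if a <= b then Rintegral lebesgue_measure `[a, b] h
  else - Rintegral lebesgue_measure `[b, a] h.

Section LinearSystems.
Variables (R : realType) (n : nat).

(* The value [nu y] of the row vector with the coordinates of [nu] at [y]. *)
Definition pairing (nu y : 'cV[R]_n) : R := \sum_xi nu xi 0 * y xi 0.

(* The functions are total on [R] but only their restriction to [J] is
   meaningful, so products, the unit and inverses are required up to equality
   on [J]. *)
Definition mx_function_group (J : set R) (G : set (R -> 'M[R]_n)) : Prop :=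
  [/\ forall g, G g -> C1_in J g /\ forall t, J t -> g t \in unitmx,
      exists2 u, G u & forall t, J t -> u t = 1%:M,
      forall g h, G g -> G h ->
        exists2 k, G k & forall t, J t -> k t = g t *m h t
    & forall g, G g -> exists2 k, G k & forall t, J t -> k t = invmx (g t)].

(* Whenever a curve [x] is differentiable at [t] or its image [y = g x] is,
   [x] satisfies the first system at [t] iff [y] satisfies the second one. *)
Definition transforms (J : set R) (g : R -> 'M[R]_n)
    (X Y : R -> 'cV[R]_n -> 'cV[R]_n) : Prop :=
  forall (x : R -> 'cV[R]_n) t, J t ->
    deriv_in J x t (X t (x t)) <->
    deriv_in J (fun s => g s *m x s) t (Y t (g t *m x t)).

Definition linear_field (A : R -> 'M[R]_n) (f : R -> 'cV[R]_n) :
    R -> 'cV[R]_n -> 'cV[R]_n :=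
  fun t x => A t *m x + f t.

Definition reducible_by (J : set R) (A : R -> 'M[R]_n) (f : R -> 'cV[R]_n)
    (B : 'M[R]_n) (g : R -> 'M[R]_n) : Prop :=
  transforms J g (linear_field A f)
    (linear_field (fun=> B) (fun t => g t *m f t)).

(* Up to a unit, the gcd of all minors of order [k] of [XE - C].  Non-injective
   selections of rows or columns only contribute zero minors. *)
Definition determinantal_divisor (C : 'M[R]_n) (k : nat) : {poly R} :=
  \big[@gcdp R/0]_(r : {ffun 'I_k -> 'I_n})
    \big[@gcdp R/0]_(c : {ffun 'I_k -> 'I_n})
      \det (mxsub r c (char_poly_mx C)).

Definition invariant_polynomial (C : 'M[R]_n) (k : nat) : {poly R} :=
  determinantal_divisor C k %/ determinantal_divisor C k.-1.

(* [('X - lam%:P) ^+ m] is an elementary divisor of [C]: the exact power of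
   ['X - lam%:P] in one of the invariant polynomials. *)
Definition elementary_divisor (C : 'M[R]_n) (lam : R) (m : nat) : Prop :=
  (0 < m)%N /\
  exists2 k, (0 < k <= n)%N & mup lam (invariant_polynomial C k) = m.

Definition eigenvector (C : 'M[R]_n) (lam : R) (v : 'cV[R]_n) : Prop :=
  v != 0 /\ C *m v = lam *: v.

Definition generalized_eigenvectors (C : 'M[R]_n) (lam : R) (m : nat)
    (nu : nat -> 'cV[R]_n) : Prop :=
  forall k, (1 <= k < m)%N ->
    nu k != 0 /\ (C - lam%:M) *m nu k = k%:R *: nu k.-1.

(* [w] lists the partial derivatives of [F] at [p = (t, x)], with respect to
   [t] first and then to the coordinates of [x], each of them relative to the
   corresponding line section of [D]. *)
Definition partials_in (D : set (R * 'cV[R]_n)) (F : R * 'cV[R]_n -> R)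
    (p : R * 'cV[R]_n) (w : 'rV[R]_(1 + n)) : Prop :=
  deriv_in [set s | D (s, p.2)] (fun s => F (s, p.2) : R^o) p.1
    (w 0 (lshift n 0)) /\
  forall xi : 'I_n,
    deriv_in [set s | D (p.1, p.2 + s *: delta_mx xi 0)]
      (fun s => F (p.1, p.2 + s *: delta_mx xi 0) : R^o) 0
      (w 0 (rshift 1 xi)).

(* For open [D] this is the usual notion; relative partial derivatives let [D]
   be [J * R^n] with an interval [J] that contains an endpoint. *)
Definition first_integral (D : set (R * 'cV[R]_n))
    (X : R -> 'cV[R]_n -> 'cV[R]_n) (F : R * 'cV[R]_n -> R) : Prop :=
  exists F' : R * 'cV[R]_n -> 'rV[R]_(1 + n),
    [/\ forall p, D p -> partials_in D F p (F' p),
        {within D, continuous F'}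
      & forall t x, D (t, x) ->
          F' (t, x) 0 (lshift n 0)
          + \sum_(xi < n) X t x xi 0 * F' (t, x) 0 (rshift 1 xi) = 0].

(* The Jacobian matrix with respect to [(t, x)] has full rank at each point. *)
Definition functionally_independent (D : set (R * 'cV[R]_n)) (q : nat)
    (F : 'I_q -> R * 'cV[R]_n -> R) : Prop :=
  forall p, D p -> exists Jac : 'M[R]_(q, 1 + n),
    (forall i, partials_in D (F i) p (row i Jac)) /\ \rank Jac = q.

End LinearSystems.

(* Main.v *)
(* Write [v_k(t, x) = nu_k g(t) x exp(-lam t) - C_k(t)] and let [D] be the
   derivative along the system.  Since [g] turns the system into [y' = B y + g f],
   [D v_k = k v_(k-1)].  The recursion for [F] says
   [v_k = sum_(j <= k) binomial(k, j) t^(k-j) F_(j+1)], so differentiating it gives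
   [D F_(k+1) = 0] by strong induction.  The functions [F_(k+1)] are affine in [x],
   and the same recursion shows that their gradients form a Jordan chain of a
   conjugate of [C - lam E]; hence they are linearly independent. *)

Require Import Defs.
From mathcomp Require Import all_boot all_order all_algebra.
From mathcomp Require Import all_classical all_reals all_analysis.
From mathcomp Require Import ring lra.

Set Implicit Arguments.
Unset Strict Implicit.
Unset Printing Implicit Defensive.

Import Order.TTheory GRing.Theory Num.Theory.
Import numFieldNormedType.Exports.

Local Open Scope classical_set_scope.
Local Open Scope ring_scope.

(** * Calculus of derivatives relative to a set *)

Section DerivIn.
Variables (R : realType) (J : set R).
Implicit Types (V : normedModType R) (t : R).

Lemma is_derive_deriv_in V (h : R -> V) t d :
  is_derive t 1 h d -> deriv_in J h t d.
Proof.
move=> hd; have : deriv_in setT h t d.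
  by apply/deriv_inP => //; rewrite interiorT.
rewrite /deriv_in; apply: cvg_trans; apply: cvg_app.
move=> P; rewrite /within /= /nbhs /=; apply: filterS => e Pe _; exact: Pe.
Qed.

(** The values at [t] are compared separately: the difference quotient uses them, but [t] is not
    assumed to lie in [J]. *)
Lemma deriv_in_eq_near V (h k : R -> V) t d :
  (\forall s \near within J (nbhs t), h s = k s) -> h t = k t ->
  deriv_in J h t d -> deriv_in J k t d.
Proof.
move=> hk hkt; rewrite /deriv_in; apply: cvg_trans; apply: near_eq_cvg.
rewrite near_withinE; apply: nbhs_dnbhs.
have et : (fun e : R => e + t) @ (0 : R) --> t.
  by rewrite -[X in _ --> X]add0r; apply: cvgD; [exact: cvg_id | exact: cvg_cst].
have {}hk : \forall e \near (0 : R), J (e + t) -> h (e + t) = k (e + t).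
  exact: et hk.
by apply: filterS hk => e /= He /He ->; rewrite hkt.
Qed.

Lemma deriv_in_eq V (h k : R -> V) t d : J t ->
  (forall s, J s -> h s = k s) -> deriv_in J h t d -> deriv_in J k t d.
Proof.
move=> Jt hk; apply: deriv_in_eq_near; last exact: hk.
by rewrite near_withinE; apply: nearW.
Qed.

Lemma deriv_in_cst V (c : V) t : deriv_in J (fun=> c) t 0.
Proof. by apply: is_derive_deriv_in; apply: is_derive_cst. Qed.

Lemma deriv_inD V (h k : R -> V) t dh dk :
  deriv_in J h t dh -> deriv_in J k t dk ->
  deriv_in J (fun s => h s + k s) t (dh + dk).
Proof.
move=> hd kd; rewrite /deriv_in.
rewrite (_ : (fun e => _) = fun e => e^-1 *: (h (e + t) - h t) +
    e^-1 *: (k (e + t) - k t)); first exact: cvgD hd kd.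
by apply/funext => e; rewrite -scalerDr opprD addrACA.
Qed.

Lemma deriv_inN V (h : R -> V) t d :
  deriv_in J h t d -> deriv_in J (fun s => - h s) t (- d).
Proof.
move=> hd; rewrite /deriv_in.
rewrite (_ : (fun e => _) = fun e => - (e^-1 *: (h (e + t) - h t))).
  exact: cvgN hd.
by apply/funext => e; rewrite -scalerN opprD.
Qed.

Lemma deriv_inB V (h k : R -> V) t dh dk :
  deriv_in J h t dh -> deriv_in J k t dk ->
  deriv_in J (fun s => h s - k s) t (dh - dk).
Proof. by move=> hd kd; apply: deriv_inD hd _; apply: deriv_inN. Qed.

Lemma deriv_in_sum V (I : eqType) (r : seq I) (h : I -> R -> V) t (d : I -> V) :
  (forall i, i \in r -> deriv_in J (h i) t (d i)) ->
  deriv_in J (fun s => \sum_(i <- r) h i s) t (\sum_(i <- r) d i).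
Proof.
elim: r => [|i r IH] hd.
  rewrite big_nil (_ : (fun s => _) = fun=> 0); first exact: deriv_in_cst.
  by apply/funext => s; rewrite big_nil.
rewrite big_cons (_ : (fun s => _) = fun s => h i s + \sum_(j <- r) h j s).
  apply: deriv_inD; first by apply: hd; rewrite mem_head.
  by apply: IH => j jr; apply: hd; rewrite inE jr orbT.
by apply/funext => s; rewrite big_cons.
Qed.

(** For [e != 0], [h (e + t)] is [e] times the difference quotient plus [h t]; the first summand
    tends to [0 *: d]. *)
Lemma deriv_in_cvg V (h : R -> V) t d :
  deriv_in J h t d ->
  h (e + t) @[e --> within [set e | J (e + t)] (0 : R)^'] --> h t.
Proof.
move=> hd; set DF := within _ _; have FDF : Filter DF by exact: within_filter.
have e0 : (fun e : R => e) @ DF --> (0 : R).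
  by move=> P HP; apply: cvg_within; apply: nbhs_dnbhs.
have : (fun e => e *: (e^-1 *: (h (e + t) - h t)) + h t) @ DF --> 0 *: d + h t.
  by apply: cvgD; [exact: cvgZ | exact: cvg_cst].
rewrite scale0r add0r; apply: cvg_trans; apply: near_eq_cvg.
rewrite near_withinE; near=> e => _ /=.
rewrite scalerA divff ?scale1r ?subrK//.
by near: e; exact: nbhs_dnbhs_neq.
Unshelve. all: by end_near. Qed.

Lemma deriv_in_continuous V (h : R -> V) t d : J t ->
  deriv_in J h t d -> h @ within J (nbhs t) --> h t.
Proof.
move=> Jt /deriv_in_cvg hc P HP; have := hc _ HP.
rewrite /within /= /dnbhs /within /= => H0.
have cs : (fun s : R => s - t) @ t --> (0 : R).
  rewrite -[X in _ --> X](subrr t).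
  by apply: cvgB; [exact: cvg_id | exact: cvg_cst].
have {}H0 : \forall s \near t, s - t != 0 -> J (s - t + t) -> P (h (s - t + t)).
  exact: (cs _ H0).
apply: filterS H0 => s /= Hs Js.
(* The punctured filter says nothing at [s = t]; there [P] holds because it is a neighbourhood of
   [h t]. *)
have [->|st] := eqVneq s t; first exact: (nbhs_singleton HP).
by move: Hs; rewrite subr_eq0 subrK; apply.
Qed.

Lemma deriv_inM (h k : R -> R) t (dh dk : R) :
  deriv_in J (h : R -> R^o) t dh -> deriv_in J (k : R -> R^o) t dk ->
  deriv_in J (fun s => h s * k s : R^o) t (dh * k t + h t * dk).
Proof.
move=> hd kd; have kc := deriv_in_cvg kd; rewrite /deriv_in.
rewrite (_ : (fun e => _) = fun e => (e^-1 *: (h (e + t) - h t : R^o)) * k (e + t) +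
    h t * (e^-1 *: (k (e + t) - k t : R^o))).
  apply: (@cvgD _ R^o); first exact: (@cvgM _ _ _ _ _ (k \o _) _ _ hd kc).
  by apply: cvgM; [exact: cvg_cst | exact: kd].
by apply/funext => e; rewrite /GRing.scale /=; ring.
Qed.

Lemma deriv_inZ (c : R) (h : R -> R) t (d : R) :
  deriv_in J (h : R -> R^o) t d ->
  deriv_in J (fun s => c * h s : R^o) t (c * d).
Proof.
move=> hd; rewrite -[c * d]add0r -(mul0r (h t)).
exact: (@deriv_inM (fun=> c)) (@deriv_in_cst R^o c t) hd.
Qed.

Lemma deriv_inX k t :
  deriv_in J (fun s => s ^+ k : R^o) t (k%:R * t ^+ k.-1).
Proof.
elim: k => [|k IH].
  rewrite mul0r (_ : (fun s => _) = fun=> 1); first exact: (@deriv_in_cst R^o).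
  by apply/funext => s; rewrite expr0.
rewrite (_ : (fun s => _) = fun s => s * s ^+ k); last first.
  by apply/funext => s; rewrite exprS.
rewrite (_ : _ * _ = 1 * t ^+ k + t * (k%:R * t ^+ k.-1)); last first.
  (* At [k = 0] the truncated exponent [k.-1] is harmless, since its factor [k%:R] is zero. *)
  case: k {IH} => [|k]; first by rewrite mul0r mulr0 addr0.
  by rewrite /= exprS -[k.+2]addn1 natrD; ring.
by apply: deriv_inM IH; apply: is_derive_deriv_in; exact: is_derive_id.
Qed.

Lemma deriv_in_expR (lam : R) t :
  deriv_in J (fun s => expR (- (lam * s)) : R^o) t
    (- lam * expR (- (lam * t))).
Proof.
apply: is_derive_deriv_in; apply: is_derive_eq.
by rewrite /GRing.scale /=; ring.
Qed.

Lemma deriv_in_entry (p q : nat) (h : R -> 'M[R]_(p, q)) t d i j :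
  deriv_in J h t d -> deriv_in J (fun s => h s i j : R^o) t (d i j).
Proof.
move=> hd; rewrite /deriv_in.
rewrite (_ : (fun e => _) = (fun M : 'M[R]_(p, q) => M i j : R^o) \o
   (fun e => e^-1 *: (h (e + t) - h t))).
  by apply: continuous_cvg hd; exact: coord_continuous.
by apply/funext => e /=; rewrite !mxE.
Qed.

(** This gives the test curve through [v] with velocity [u] for the reduction hypothesis, and also
    the partial derivatives of functions affine in [x]. *)
Lemma deriv_in_line V (v u : V) t :
  deriv_in J (fun s => v + (s - t) *: u) t u.
Proof.
rewrite /deriv_in; set DF := within _ _.
have : (fun=> u) @ DF --> u by exact: cvg_cst.
apply: cvg_trans; apply: near_eq_cvg; rewrite near_withinE; near=> e => _ /=.
rewrite subrr scale0r addr0 addrK addrAC subrr add0r scalerA mulVf ?scale1r//.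
by near: e; exact: nbhs_dnbhs_neq.
Unshelve. all: by end_near. Qed.

End DerivIn.

(** * The fundamental theorem of calculus relative to an interval *)

Section IntervalIntegral.
Variables (R : realType) (J : set R).
Hypothesis J_itv : is_interval J.

(** The segment [[a, b]] holds both the base point and a relative neighbourhood of [t], so
    continuity on [J] can be used on a compact set even when [t] is an endpoint of [J]. *)
Lemma compact_neighborhood_in t0 t : J t0 -> J t ->
  exists a b, [/\ J a, J b, a <= t0 <= b, a <= t <= b
    & \forall s \near within J (nbhs t), a <= s <= b].
Proof.
move=> J0 Jt.
have [a [Ja a0 at_ an]] : exists a, [/\ J a, a <= t0, a <= t &
    \forall s \near within J (nbhs t), a <= s].
  (* Either [J] has a point [u] to the left of [t], or [t] is its left end and bounds [J] from
     below. *)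
  have [[u Ju ut]|nu] := pselect (exists2 u, J u & u < t).
    exists (Num.min u t0); split.
    - by rewrite /Num.min; case: ifP.
    - by rewrite ge_min lexx orbT.
    - by rewrite ge_min (ltW ut).
    - rewrite near_withinE; near=> s => _; rewrite ge_min; apply/orP; left.
      by near: s; exact: lt_le_nbhsr.
  exists (Num.min t t0); split.
  - by rewrite /Num.min; case: ifP.
  - by rewrite ge_min lexx orbT.
  - by rewrite ge_min lexx.
  - rewrite near_withinE; apply: nearW => s Js; rewrite ge_min; apply/orP; left.
    by rewrite leNgt; apply/negP => st; apply: nu; exists s.
have [b [Jb b0 bt bn]] : exists b, [/\ J b, t0 <= b, t <= b &
    \forall s \near within J (nbhs t), s <= b].
  have [[u Ju ut]|nu] := pselect (exists2 u, J u & t < u).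
    exists (Num.max u t0); split.
    - by rewrite /Num.max; case: ifP.
    - by rewrite le_max lexx orbT.
    - by rewrite le_max (ltW ut).
    - rewrite near_withinE; near=> s => _; rewrite le_max; apply/orP; left.
      by near: s; exact: lt_le_nbhsl.
  exists (Num.max t t0); split.
  - by rewrite /Num.max; case: ifP.
  - by rewrite le_max lexx orbT.
  - by rewrite le_max lexx.
  - rewrite near_withinE; apply: nearW => s Js; rewrite le_max; apply/orP; left.
    by rewrite leNgt; apply/negP => st; apply: nu; exists s.
exists a, b; rewrite a0 b0 at_ bt; split => //.
by apply: filterS2 an bn => s -> ->.
Unshelve. all: by end_near. Qed.

(** The integrand is continuous on [J] only. Replacing it by a continuous function on the whole line
    that agrees with it on [[a, b]] makes the two-sided theorem applicable at [t]; the result is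
    then restricted to [J]. *)
Lemma deriv_in_oriented_integral (h : R -> R) t0 t : J t0 -> J t ->
  {within J, continuous h} ->
  deriv_in J (fun s => oriented_integral t0 s h : R^o) t (h t).
Proof.
move=> J0 Jt hc.
have [a [b [Ja Jb at0 abt nt]]] := compact_neighborhood_in J0 Jt.
(* Clamping to [[a, b]] extends [h] by its end values. *)
pose cl (x : R) := Num.max a (Num.min b x).
have clE x : a <= x <= b -> cl x = x.
  by move=> /andP[ax xb]; rewrite /cl min_r ?max_r.
have ab : a <= b by case/andP: abt; exact: le_trans.
have clJ x : J (cl x).
  apply: (J_itv Ja Jb); rewrite /cl le_max lexx /=.
  by rewrite ge_max ab ge_min lexx.
pose k := h \o cl.
have kc : continuous k.
  move=> x; have clc : cl @ x --> cl x.
    apply: continuous_max; first exact: cvg_cst.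
    by apply: continuous_min; [exact: cvg_cst | exact: cvg_id].
  move/subspace_continuousP : hc => /(_ _ (clJ x)) hx.
  move=> P HP; have {}HP : \forall y \near cl x, J y -> P (h y) by exact: hx HP.
  have {}HP : \forall y \near x, J (cl y) -> P (h (cl y)) by exact: (clc _ HP).
  by apply: filterS HP => y /(_ (clJ y)).
(* The lower limit [a - 1] keeps [t] strictly inside the domain of integration even when [t = a]. *)
pose F (x : R) : R := \int[lebesgue_measure]_(y in `[a - 1, x]) k y.
have kint (I : interval R) u v : [set` I] `<=` `[u, v] ->
    lebesgue_measure.-integrable [set` I] (EFin \o k).
  move=> Iuv.
  have kuv : lebesgue_measure.-integrable `[u, v] (EFin \o k).
    apply: continuous_compact_integrable; first exact: segment_compact.
    exact: continuous_subspaceT.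
  exact: integrableS kuv.
have Fd : is_derive t 1 (F : R -> R^o) (k t).
  have := @continuous_FTC1 R k (BLeft (a - 1)) t (t + 1).
  case=> //; first by lra.
  - exact: (kint _ (a - 1) (t + 1)).
  - by rewrite lte_fin; move: abt; lra.
  - exact: kc.
  move=> dF dFE; rewrite -dFE derive1E; exact: derivableP.
have Fsub x y : a <= x -> x <= y -> y <= b ->
    \int[lebesgue_measure]_(z in `[x, y]) h z = F y - F x.
  move=> ax xy yb; rewrite /F Rintegral_itvB; first last.
  - by rewrite bnd_simp.
  - by rewrite bnd_simp; lra.
  - exact: (kint _ (a - 1) y).
  rewrite Rintegral_itv_obnd_cbnd; last first.
    by apply: (kint _ x y); apply: subset_itvr; rewrite bnd_simp.
  apply: eq_Rintegral => z; rewrite inE /= in_itv /= => /andP[xz zy].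
  rewrite /k /= clE// (le_trans ax xz)/=; exact: le_trans yb.
(* Both orientations of the integral reduce to the same difference of primitives. *)
have OE s : a <= s <= b -> oriented_integral t0 s h = F s - F t0.
  move=> /andP[as_ sb]; move/andP: at0 => [a0 b0]; rewrite /oriented_integral.
  case: ifPn => [t0s|]; first exact: Fsub.
  by rewrite -ltNge => /ltW st0; rewrite Fsub// opprB.
apply: (@deriv_in_eq_near _ _ _ (fun s => F s - F t0 : R^o)).
- by apply: filterS nt => s sab; rewrite OE.
- by rewrite OE.
- rewrite -[h t]subr0; apply: deriv_inB; last exact: deriv_in_cst.
  have -> : h t = k t by rewrite /k /= clE.
  exact: is_derive_deriv_in.
Qed.

End IntervalIntegral.

(** * Jordan chains with the normalisation [N v_k = k v_(k-1)] *)

Section JordanChain.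
Variables (K : numFieldType) (n m : nat) (N : 'M[K]_n).

(** Applying [N] to a linear relation removes the [v 0] term and shifts the others down, leaving a
    shorter relation with coefficients [a_(k+1) (k+1)]. By induction these vanish, and the factors
    [k+1] are non-zero in characteristic zero, so only [a_0 v_0 = 0] remains. *)
Lemma jordan_chain_free (v : nat -> 'cV[K]_n) :
  v 0%N != 0 -> (forall k, (k < m)%N -> N *m v k = k%:R *: v k.-1) ->
  forall (q : nat) (a : nat -> K), (q <= m)%N ->
    \sum_(k < q) a k *: v k = 0 -> forall k, (k < q)%N -> a k = 0.
Proof.
move=> v0 Nv; elim=> [//|q IH] a qm av0.
have aS k : (k < q)%N -> a k.+1 = 0.
  move=> kq; suff : a k.+1 * k.+1%:R = 0.
    by move/eqP; rewrite mulf_eq0 pnatr_eq0 orbF => /eqP.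
  apply: (IH (fun k => a k.+1 * k.+1%:R)) => //; first exact: ltnW.
  have := congr1 (mulmx N) av0.
  rewrite mulmx0 mulmx_sumr big_ord_recl /= -scalemxAr Nv; last exact: leq_trans qm.
  rewrite scale0r scaler0 add0r => {2}<-; apply: eq_bigr => i _.
  by rewrite -scalemxAr Nv ?scalerA//; apply: leq_trans qm; rewrite ltnS.
case=> [_|k kq]; last exact: aS.
move: av0; rewrite big_ord_recl big1 => [|i _]; last first.
  by rewrite aS ?scale0r// ltn_ord.
by rewrite addr0 => /eqP; rewrite scaler_eq0 (negbTE v0) orbF => /eqP.
Qed.

(* [w k] is the image of [(X - t) ^+ k] under the linear map ['X^k |-> u k]. *)
Lemma jordan_chain_shift (t : K) (u w : nat -> 'cV[K]_n) :
  (forall k, (k < m)%N -> N *m u k = k%:R *: u k.-1) ->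
  (forall k, (k < m)%N ->
     w k = u k - \sum_(0 <= j < k) ('C(k, j)%:R * t ^+ (k - j)) *: w j) ->
  forall k, (k < m)%N -> N *m w k = k%:R *: w k.-1.
Proof.
move=> Nu wE; elim/ltn_ind => -[|k] IH km.
  by rewrite wE// big_nil subr0 Nu// !scale0r.
rewrite [in LHS]wE// mulmxBr Nu// mulmx_sumr big_nat_recl//= -scalemxAr.
rewrite IH// ?(ltn_trans _ km)// scale0r scaler0 add0r.
rewrite [in RHS]wE; last exact: ltn_trans km.
rewrite scalerBr scaler_sumr; congr (_ - _); apply: eq_big_nat => i /andP[_ ik].
rewrite -scalemxAr IH ?ltnS//; last by rewrite (leq_trans _ km)// ltnS ltnW.
(* The coefficients agree because [(k+1) binomial(k, i) = (i+1) binomial(k+1, i+1)]. *)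
by rewrite /= !scalerA subSS mulrAC mulrA -!natrM mul_bin_diag [(_ * i.+1)%N]mulnC.
Qed.

End JordanChain.

(** Differentiating the powers of [s] in the recursion produces exactly the terms [k a_(k-1)], which
    cancel. What is left is the same recursion with [b] in place of [a], and this determines [W]. *)
Lemma deriv_in_binomial_recursion (R : realType) (J : set R) (m : nat)
    (a Phi : nat -> R -> R) (b W : nat -> R) t : J t ->
  (forall k, (k < m)%N ->
     deriv_in J (a k : R -> R^o) t (k%:R * a k.-1 t + b k)) ->
  (forall k s, (k < m)%N -> J s ->
     Phi k s = a k s - \sum_(0 <= j < k) 'C(k, j)%:R * s ^+ (k - j) * Phi j s) ->
  (forall k, (k < m)%N ->
     W k = b k - \sum_(0 <= j < k) 'C(k, j)%:R * t ^+ (k - j) * W j) ->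
  forall k, (k < m)%N -> deriv_in J (Phi k : R -> R^o) t (W k).
Proof.
move=> Jt da PhiE WE; elim/ltn_ind => k IH km.
apply: (@deriv_in_eq _ _ R^o (fun s => a k s -
    \sum_(0 <= j < k) 'C(k, j)%:R * s ^+ (k - j) * Phi j s)) => //.
  by move=> s Js; rewrite -PhiE.
rewrite (_ : W k = k%:R * a k.-1 t + b k - \sum_(0 <= j < k)
   ('C(k, j)%:R * ((k - j)%:R * t ^+ (k - j).-1) * Phi j t +
    'C(k, j)%:R * t ^+ (k - j) * W j)).
  apply: deriv_inB; first exact: da.
  apply: deriv_in_sum => j; rewrite mem_index_iota => /andP[_ jk].
  apply: deriv_inM; first by apply: deriv_inZ; exact: deriv_inX.
  by apply: IH => //; exact: ltn_trans km.
rewrite WE// big_split /= opprD addrA; congr (_ - _).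
case: k {IH} km => [|k] km; first by rewrite big_nil mul0r add0r subr0.
(* Solving the recursion for [a k] turns the cancellation into [(k+1) binomial(k, j) = (k+1-j)
   binomial(k+1, j)]; the term [j = k] enters with coefficient 1. *)
suff -> : a k t = \sum_(0 <= j < k.+1) 'C(k, j)%:R * t ^+ (k - j) * Phi j t.
  rewrite mulr_sumr addrAC -sumrB big_nat big1 ?add0r// => j /andP[_ jk].
  rewrite !mulrA -!natrM [in X in _ - X]mulnC -mul_bin_down /= subSn//=.
  by rewrite subrr.
rewrite big_nat_recr//= subnn expr0 binn !mul1r PhiE ?(ltn_trans _ km)//.
by rewrite addrC subrK.
Qed.

(** * Entrywise convergence of matrices *)

Lemma cvg_mx (R : numFieldType) (T : Type) (p q : nat) (D : set_system T)
    (FD : Filter D) (h : T -> 'M[R]_(p, q)) (M : 'M[R]_(p, q)) :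
  (forall i j, h x i j @[x --> D] --> M i j) -> h @ D --> M.
Proof.
move=> hM P [Q MQ QP].
(* A neighbourhood of [M] contains a box [Q] of entrywise neighbourhoods, and finitely many eventual
   conditions hold jointly. *)
have : \forall x \near D, forall i j, Q i j (h x i j).
  apply: filter_forall => i; apply: filter_forall => j.
  exact: hM i j _ (MQ i j).
by apply: filterS => x Qx; exact: QP.
Qed.

Lemma cvg_entry (R : numFieldType) (T : Type) (p q : nat) (D : set_system T)
    (FD : Filter D) (h : T -> 'M[R]_(p, q)) (M : 'M[R]_(p, q)) i j :
  h @ D --> M -> h x i j @[x --> D] --> M i j.
Proof.
exact: (@continuous_cvg _ _ _ D FD h (fun M => M i j) M (@coord_continuous _ _ _ i j M)).
Qed.

Lemma cvg_mulmx (R : numFieldType) (T : Type) (D : set_system T) (FD : Filter D)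
    (p q r : nat) (h : T -> 'M[R]_(p, q)) (k : T -> 'M[R]_(q, r))
    (M : 'M[R]_(p, q)) (N : 'M[R]_(q, r)) :
  h @ D --> M -> k @ D --> N -> h x *m k x @[x --> D] --> M *m N.
Proof.
move=> hM kN; apply: cvg_mx => i j; rewrite mxE.
rewrite (_ : (fun x => _) = fun x => \sum_l h x i l * k x l j); last first.
  by apply/funext => x; rewrite mxE.
apply: (cvg_big add_continuous) => l _; apply: cvgM.
  exact: cvg_entry hM.
exact: cvg_entry kN.
Qed.

(** * Bilinearity and continuity of the pairing *)

Section Pairing.
Variables (R : realType) (n : nat).
Implicit Types (nu y : 'cV[R]_n).

Lemma pairingE nu y : pairing nu y = (nu^T *m y) 0 0.
Proof. by rewrite mxE; apply: eq_bigr => i _; rewrite mxE. Qed.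

Lemma pairingDr nu y z : pairing nu (y + z) = pairing nu y + pairing nu z.
Proof. by rewrite !pairingE mulmxDr mxE. Qed.

Lemma pairingBr nu y z : pairing nu (y - z) = pairing nu y - pairing nu z.
Proof. by rewrite !pairingE mulmxBr !mxE. Qed.

Lemma pairingZr nu c y : pairing nu (c *: y) = c * pairing nu y.
Proof. by rewrite !pairingE -scalemxAr mxE. Qed.

Lemma pairingDl nu1 nu2 y : pairing (nu1 + nu2) y = pairing nu1 y + pairing nu2 y.
Proof. by rewrite !pairingE linearD /= mulmxDl mxE. Qed.

Lemma pairingBl nu1 nu2 y : pairing (nu1 - nu2) y = pairing nu1 y - pairing nu2 y.
Proof. by rewrite !pairingE linearB /= mulmxBl !mxE. Qed.

Lemma pairingZl c nu y : pairing (c *: nu) y = c * pairing nu y.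
Proof. by rewrite !pairingE linearZ /= -scalemxAl mxE. Qed.

Lemma pairing_suml (I : Type) (r : seq I) (nu : I -> 'cV[R]_n) y :
  pairing (\sum_(i <- r) nu i) y = \sum_(i <- r) pairing (nu i) y.
Proof.
by rewrite pairingE linear_sum /= mulmx_suml summxE; apply: eq_bigr => i _;
  rewrite pairingE.
Qed.

Lemma pairing_mulmxr nu (M : 'M[R]_n) y :
  pairing nu (M *m y) = pairing (M^T *m nu) y.
Proof. by rewrite !pairingE trmx_mul trmxK mulmxA. Qed.

Lemma pairing_delta nu xi : pairing nu (delta_mx xi 0) = nu xi 0.
Proof. by rewrite pairingE -colE !mxE. Qed.

Lemma cvg_pairing (T : Type) (D : set_system T) (FD : Filter D)
    (h k : T -> 'cV[R]_n) nu y :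
  h @ D --> nu -> k @ D --> y ->
  pairing (h x) (k x) @[x --> D] --> pairing nu y.
Proof.
move=> hnu ky; apply: (cvg_big add_continuous) => xi _; apply: cvgM.
  exact: cvg_entry hnu.
exact: cvg_entry ky.
Qed.

End Pairing.

(** * The first integrals and their independence *)

Theorem theorem3p6 (R : realType) (n : nat) (J : set R)
    (A : R -> 'M[R]_n) (f : R -> 'cV[R]_n) (G : set (R -> 'M[R]_n))
    (g : R -> 'M[R]_n) (B C : 'M[R]_n) (lam : R) (m : nat)
    (nu : nat -> 'cV[R]_n) (t0 : R)
    (Ck : nat -> R -> R) (F : nat -> R * 'cV[R]_n -> R)
    (J_itv : is_interval J) (J_int : J° !=set0)
    (A_cont : {within J, continuous A}) (f_cont : {within J, continuous f})
    (G_group : mx_function_group J G)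
    (g_in_G : G g) (g_red : reducible_by J A f B g)
    (C_def : C = B^T)
    (m_ge2 : (2 <= m)%N) (lam_div : elementary_divisor C lam m)
    (nu0_eig : eigenvector C lam (nu 0%N))
    (nu_gen : generalized_eigenvectors C lam m nu)
    (t0_J : J t0)
    (Ck_def : forall k t, (k < m)%N -> J t ->
       Ck k t = oriented_integral t0 t (fun z =>
         pairing (nu k) (g z *m f z) * expR (- (lam * z))
         + k%:R * Ck k.-1 z))
    (F1_def : forall t x, J t ->
       F 1%N (t, x) = pairing (nu 0%N) (g t *m x) * expR (- (lam * t)) - Ck 0%N t)
    (F_def : forall k t x, (1 <= k < m)%N -> J t ->
       F k.+1 (t, x) = pairing (nu k) (g t *m x) * expR (- (lam * t))
         - \sum_(0 <= tau < k) 'C(k, tau)%:R * t ^+ (k - tau) * F tau.+1 (t, x)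
         - Ck k t) :
  (forall k, (1 <= k < m)%N ->
     first_integral (J `*` [set: 'cV[R]_n]) (linear_field A f) (F k.+1)) /\
  functionally_independent (J `*` [set: 'cV[R]_n])
    (fun i : 'I_m.-1 => F i.+2).
Proof.
set D := J `*` [set: 'cV[R]_n].
have C1g : C1_in J g by case: G_group => + _ _ _ => /(_ g g_in_G)[].
have g_unit t : J t -> g t \in unitmx by case: G_group => + _ _ _ => /(_ g g_in_G)[_]; apply.
have [g' [dg _]] := C1g.
have g_cont t : J t -> g @ within J (nbhs t) --> g t.
  by move=> Jt; apply: (deriv_in_continuous Jt (dg t Jt)).
have A_cvg := (subspace_continuousP _ _).1 A_cont.
have f_cvg := (subspace_continuousP _ _).1 f_cont.
pose E (t : R) := expR (- (lam * t)).
have dE t : deriv_in J (E : R -> R^o) t (- lam * E t) by exact: deriv_in_expR.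
have E_cvg t : J t -> E @ within J (nbhs t) --> E t.
  by move=> Jt; exact: (deriv_in_continuous Jt (dE t)).
pose X t x := linear_field A f t x.
(* The hypothesis on [g] applies to the line [s |-> x + (s - t) X] tangent to a
   solution, and [g x = g (x + (s - t) X) - (s - t) g X]. *)
have dgx t x i : J t -> deriv_in J (fun s => (g s *m x) i 0 : R^o) t
    ((B *m (g t *m x) + g t *m f t - g t *m X t x) i 0).
  move=> Jt; pose c s := x + (s - t) *: X t x.
  have ct : c t = x by rewrite /c subrr scale0r addr0.
  have /(g_red _ _ Jt) : deriv_in J c t (linear_field A f t (c t)).
    by rewrite ct; exact: deriv_in_line.
  rewrite /linear_field ct => /(@deriv_in_entry _ _ _ _ _ _ _ i 0) dgc.
  have dgX : deriv_in J (fun s => (g s *m X t x) i 0 : R^o) t ((g' t *m X t x) i 0).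
    have mulE (M : 'M[R]_n) : (M *m X t x) i 0 = \sum_j X t x j 0 * M i j.
      by rewrite mxE; apply: eq_bigr => j _; rewrite mulrC.
    rewrite mulE (_ : (fun s => _) = fun s => \sum_j X t x j 0 * g s i j).
      apply: (@deriv_in_sum _ _ R^o) => j _; apply: (deriv_inZ _ (h := fun s => g s i j)).
      exact: deriv_in_entry (dg t Jt).
    by apply/funext => s; rewrite mulE.
  have dl : deriv_in J (fun s => s - t : R^o) t 1.
    rewrite -[1]subr0; apply: (@deriv_inB _ _ R^o) => //; last exact: (@deriv_in_cst _ _ R^o).
    by apply: is_derive_deriv_in; exact: is_derive_id.
  (* The factor [s - t] vanishes at [t], so the product rule leaves only [g t *m X t x] from the
     second term. *)
  have := @deriv_inB _ _ R^o _ _ _ _ _ dgc (deriv_inM dl dgX).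
  rewrite subrr mul0r addr0 mul1r !mxE.
  apply: (@deriv_in_eq _ _ R^o) => // s _.
  by rewrite /c mulmxDr -scalemxAr !mxE addrK.
pose phi k z := pairing (nu k) (g z *m f z) * E z.
have phi_cvg k t : J t -> phi k @ within J (nbhs t) --> phi k t.
  move=> Jt; apply: cvgM (E_cvg t Jt).
  apply: cvg_pairing; first exact: cvg_cst.
  by apply: cvg_mulmx; [exact: g_cont | exact: f_cvg].
(* Continuity of the previous term is a separate premise: for [k = 0] the expression [Ck k.-1] is
   [Ck 0] itself, and the zero factor makes the premise trivial; later it follows from
   differentiability of [Ck k.-1]. *)
have dCk_step k : (k < m)%N -> (forall z, J z ->
      (fun s => k%:R * Ck k.-1 s) @ within J (nbhs z) --> k%:R * Ck k.-1 z) ->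
    forall t, J t -> deriv_in J (Ck k : R -> R^o) t (phi k t + k%:R * Ck k.-1 t).
  move=> km prev_cvg t Jt; apply: (@deriv_in_eq _ _ R^o (fun s =>
      oriented_integral t0 s (fun z => phi k z + k%:R * Ck k.-1 z))) => //.
    by move=> s Js; rewrite [RHS]Ck_def.
  apply: (deriv_in_oriented_integral J_itv t0_J Jt (h := fun z => _ + _)).
  apply/subspace_continuousP => z Jz.
  by apply: cvgD; [exact: phi_cvg | exact: prev_cvg].
have dCk k : (k < m)%N -> forall t, J t ->
    deriv_in J (Ck k : R -> R^o) t (phi k t + k%:R * Ck k.-1 t).
  elim: k => [|k IH] km; apply: dCk_step => // z Jz.
    rewrite mul0r (_ : (fun s => _) = fun=> 0); first exact: cvg_cst.
    by apply/funext => s; rewrite mul0r.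
  apply: cvgM; first exact: cvg_cst.
  exact: (deriv_in_continuous Jz (IH (ltnW km) z Jz)).
(* This is [v_k] with [x] frozen, so its derivative in [s] is a partial derivative in time. *)
pose a k x s := pairing (nu k) (g s *m x) * E s - Ck k s.
have nuE k : (k < m)%N -> (C - lam%:M) *m nu k = k%:R *: nu k.-1.
  case: k => [_|k km]; last exact: (nu_gen k.+1 km).2.
  by rewrite scale0r mulmxBl nu0_eig.2 mul_scalar_mx subrr.
have FE k t x : (k < m)%N -> J t -> F k.+1 (t, x) =
    a k x t - \sum_(0 <= j < k) 'C(k, j)%:R * t ^+ (k - j) * F j.+1 (t, x).
  case: k => [_|k km] Jt; first by rewrite big_nil subr0 F1_def.
  by rewrite F_def// addrAC.
(* [om k t] is the gradient of [v_k] in [x], and [w k t] will be that of [F k.+1]. The latter is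
   read off from values at basis vectors, which is justified once [F k.+1] is known to be affine in
   [x]. *)
pose om k t := E t *: ((g t)^T *m nu k).
pose w k t := \col_xi (F k.+1 (t, delta_mx xi 0) - F k.+1 (t, 0)).
have omE k t x : pairing (om k t) x = a k x t - a k 0 t.
  rewrite /a mulmx0 opprB addrA subrK pairingZl -pairing_mulmxr mulrC.
  by rewrite [pairing _ 0]pairingE mulmx0 mxE mul0r subr0.
have wE k t : (k < m)%N -> J t ->
    w k t = om k t - \sum_(0 <= j < k) ('C(k, j)%:R * t ^+ (k - j)) *: w j t.
  move=> km Jt; apply/colP => xi; rewrite -[RHS]pairing_delta pairingBl omE.
  rewrite pairing_suml mxE !FE// opprD addrACA -opprD -sumrB.
  congr (_ - _); apply: eq_bigr => j _.
  by rewrite pairingZl pairing_delta mxE mulrBr.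
have pw_rec k t x : (k < m)%N -> J t -> pairing (w k t) x =
    pairing (om k t) x - \sum_(0 <= j < k) 'C(k, j)%:R * t ^+ (k - j) * pairing (w j t) x.
  move=> km Jt; rewrite wE// pairingBl pairing_suml; congr (_ - _).
  by apply: eq_bigr => j _; rewrite pairingZl.
have F_aff k t x : (k < m)%N -> J t -> F k.+1 (t, x) = F k.+1 (t, 0) + pairing (w k t) x.
  move=> + Jt; elim/ltn_ind: k => k IH km; rewrite pw_rec// omE !FE//.
  rewrite [in LHS](_ : \sum_(_ <= _ < _) _ =
      \sum_(0 <= j < k) 'C(k, j)%:R * t ^+ (k - j) * F j.+1 (t, 0) +
      \sum_(0 <= j < k) 'C(k, j)%:R * t ^+ (k - j) * pairing (w j t) x).
    by ring.
  rewrite -big_split; apply: eq_big_nat => j /andP[_ jk] /=.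
  by rewrite (IH j)// ?(ltn_trans jk)// mulrDr.
have da k t x : (k < m)%N -> J t ->
    deriv_in J (a k x : R -> R^o) t (k%:R * a k.-1 x t - pairing (om k t) (X t x)).
  move=> km Jt.
  have dp : deriv_in J (fun s => pairing (nu k) (g s *m x) : R^o) t
      (pairing (nu k) (B *m (g t *m x) + g t *m f t - g t *m X t x)).
    by apply: (@deriv_in_sum _ _ R^o) => i _; apply: deriv_inZ; exact: dgx.
  have := @deriv_inB _ _ R^o _ _ _ _ _ (deriv_inM dp (dE t)) (dCk k km t Jt).
  congr deriv_in; rewrite /a pairingBr pairingDr pairing_mulmxr -C_def.
  (* The [lam] part cancels the derivative of the exponential, and the [f] part cancels [phi k] from
     the derivative of [Ck k]. *)
  have -> : C *m nu k = lam *: nu k + k%:R *: nu k.-1.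
    by rewrite -nuE// mulmxBl mul_scalar_mx addrC subrK.
  by rewrite /om pairingDl !pairingZl -pairing_mulmxr /phi; ring.
have dF k t x : (k < m)%N -> J t ->
    deriv_in J (fun s => F k.+1 (s, x) : R^o) t (- pairing (w k t) (X t x)).
  move=> km Jt.
  apply: (@deriv_in_binomial_recursion _ _ m (a^~ x) (fun k s => F k.+1 (s, x))
    (fun k => - pairing (om k t) (X t x)) (fun k => - pairing (w k t) (X t x))) => //.
  - by move=> j jm; exact: da.
  - by move=> j s jm Js; exact: FE.
  - move=> j jm; rewrite pw_rec// opprB addrC; congr (_ + _).
    by rewrite -sumrN; apply: eq_bigr => i _; rewrite mulrN opprK.
have w_cvg k t : (k < m)%N -> J t -> w k @ within J (nbhs t) --> w k t.
  move=> km Jt; apply: cvg_mx => i j; rewrite mxE.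
  rewrite (_ : (fun s => _) = fun s => F k.+1 (s, delta_mx i 0) - F k.+1 (s, 0)).
    by apply: cvgB; exact: (deriv_in_continuous Jt (dF k t _ km Jt)).
  by apply/funext => s; rewrite mxE.
(* By [dF] the time derivative is minus the pairing of the spatial gradient with the field; this is
   already the equation of a first integral. *)
pose F' k (p : R * 'cV[R]_n) : 'rV[R]_(1 + n) :=
  row_mx (- pairing (w k p.1) (X p.1 p.2))%:M (w k p.1)^T.
have F'l k p : F' k p 0 (lshift n 0) = - pairing (w k p.1) (X p.1 p.2).
  by rewrite row_mxEl mxE eqxx mulr1n.
have F'r k p xi : F' k p 0 (rshift 1 xi) = w k p.1 xi 0.
  by rewrite row_mxEr mxE.
have partF k p : (k < m)%N -> D p -> partials_in D (F k.+1) p (F' k p).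
  case: p => t x km [/= Jt _]; split => [|xi]; rewrite ?F'l ?F'r /=.
    rewrite (_ : [set s | D (s, x)] = J); first exact: dF.
    by apply/seteqP; split => s /=; [case | split].
  (* Along a coordinate direction [F k.+1] is affine with slope [w k t xi 0]. *)
  rewrite (_ : (fun s => _) = fun s => F k.+1 (t, x) + (s - 0) *: (w k t xi 0 : R^o)).
    exact: deriv_in_line.
  apply/funext => s; rewrite [LHS]F_aff// [in RHS]F_aff// pairingDr pairingZr.
  by rewrite pairing_delta subr0 addrA.
split => [k /andP[k0 km]|[t x] Dp].
  exists (F' k); split.
  - by move=> p Dp; exact: partF.
  - apply/subspace_continuousP => -[t x] [/= Jt _].
    have c1 (V : topologicalType) (c : R -> V) : c @ within J (nbhs t) --> c t ->
        (fun p : R * 'cV[R]_n => c p.1) @ within D (nbhs (t, x)) --> c t.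
      move=> ct P HP; have {}HP : \forall s \near t, J s -> P (c s) by exact: ct HP.
      have : \forall p \near (t, x), J p.1 -> P (c p.1).
        by have /(_ _ HP) : fst @ (t, x) --> t by exact: cvg_fst.
      by apply: filterS => p Hp [/Hp].
    have c2 : snd @ within D (nbhs (t, x)) --> x.
      by apply: cvg_within_filter; exact: cvg_snd.
    have cw := c1 _ (w k) (w_cvg k t km Jt).
    apply: cvg_mx => i j; rewrite (ord1 i); case: (split_ordP j) => j' ->.
      rewrite (ord1 j') F'l; under eq_fun do rewrite F'l.
      apply: cvgN; apply: cvg_pairing cw _; apply: cvgD.
        by apply: cvg_mulmx c2; apply: c1; exact: A_cvg.
      by apply: c1; exact: f_cvg.
    rewrite F'r; under eq_fun do rewrite F'r.
    exact: cvg_entry cw.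
  - move=> t x [/= Jt _]; rewrite F'l /=.
    under eq_bigr do rewrite F'r /= mulrC.
    by rewrite addNr.

(* Rank of the Jacobian matrix *)
case: (Dp) => /= Jt _.
exists (\matrix_i F' i.+1 (t, x)); split => [i|].
  by rewrite rowK; apply: partF => //; rewrite -ltn_predRL ltn_ord.
apply/eqP; apply: inj_row_free => v vJ.
(* The spatial columns of a relation between the Jacobian rows give a relation between
   [w 1, ..., w m.-1]. *)
have vw : \sum_(i < m.-1) v 0 i *: w i.+1 t = 0.
  apply/colP => xi; rewrite summxE mxE.
  have := congr1 (fun M : 'rV_(1 + n) => M 0 (rshift 1 xi)) vJ.
  rewrite !mxE => {2}<-; apply: eq_bigr => i _; rewrite !mxE.
  by rewrite (unsplitK (inr xi)) !mxE.
(* The chain begins at [w 0], which belongs to [F 1] and is not in the family; the relation is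
   padded with coefficient 0 there. *)
pose al k := if k is j.+1 then oapp (v 0) 0 (insub j) else 0.
have alS (i : 'I_m.-1) : al i.+1 = v 0 i by rewrite /al valK.
(* [P] is invertible and maps [nu k] to [om k t]. Hence the [om k t] form a chain for the conjugate
   of [C - lam%:M] by [P], and the binomial recursion passes this on to the [w k t]. *)
pose P := E t *: (g t)^T.
have Pu : P \in unitmx.
  by rewrite unitmxZ ?unitmx_tr ?g_unit// unitfE gt_eqF// expR_gt0.
have omP k : om k t = P *m nu k by rewrite /om -scalemxAl.
have NE k : (k < m)%N -> (P *m (C - lam%:M) *m invmx P) *m w k t = k%:R *: w k.-1 t.
  move: k; apply: (jordan_chain_shift (t := t) (u := om^~ t) (w := w^~ t)) => j jm.
    by rewrite !omP mulmxA mulmxKV// -mulmxA nuE// scalemxAr.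
  by rewrite wE.
have w0 : w 0%N t != 0.
  rewrite wE ?(ltn_trans _ m_ge2)// big_nil subr0 omP.
  apply: contra_neq nu0_eig.1 => /(congr1 (mulmx (invmx P))).
  by rewrite mulKmx// mulmx0.
have alE := jordan_chain_free (v := w^~ t) w0 NE (leqnn m) (a := al).
have mE : m = m.-1.+1 by rewrite prednK// (ltn_trans _ m_ge2).
have al0 : \sum_(k < m) al k *: w k t = 0.
  rewrite mE big_ord_recl scale0r add0r -[RHS]vw; apply: eq_bigr => i _.
  by rewrite lift0 alS.
apply/rowP => i; rewrite mxE -alS alE//.
by rewrite -ltn_predRL ltn_ord.
Qed.
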